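(* Let $k$ be a field and $G$ a (totally) ordered abelian group. Let $R\subseteq\mathrm{LRS}(k,G)$ be such that $K=\langle R\rangle$ is a Hahn field. Suppose that for any $(\rho,\tau)\in\mathrm{Aut}(k)\times\mathrm{o\text{-}Aut}(G)$ we have $\widetilde{\rho\tau}^*(R)\subseteq R$. Then $K$ has the canonical first lifting property.
   Context: $k((G))$ denotes the field of generalised power series: all functions $s\colon G\to k$, written $s=\sum_{g\in G}s_gt^g$, whose support $\mathrm{supp}(s)=\{g\mid s_g\neq 0\}$ is a well-ordered subset of $G$, with pointwise addition and convolution product. $k[G]$ is the subring of all $s$ with finite support and $k(G)$ its fraction field inside $k((G))$. A Hahn field is a field $K$ with $k(G)\subseteq K\subseteq k((G))$; it carries the canonical valuation $v(s)=\min\mathrm{supp}(s)$ for $s\neq 0$. Linear recurrence sequences: $\mathrm{LRS}(k,G)$ is the set of partial functions $r\colon G\rightharpoonup k$ with well-ordered domain $\mathrm{dom}(r)$. $\mathrm{supp}(r)=\{g\in\mathrm{dom}(r)\mid r(g)\neq 0\}$ and $r^*=\sum_{g\in\mathrm{dom}(r)}r(g)t^g\in k((G))$. $\langle r\rangle$ is the set of all $s\in k((G))$ with $\sum_{g\in\mathrm{dom}(r)}r(g)s_{h-g}=0$ for every $h\in G\setminus\mathrm{dom}(r)$ (a sum with finitely many non-zero terms), and $\langle R\rangle=\bigcup_{r\in R}\langle r\rangle$. Associated maps: for $r\in\mathrm{LRS}(k,G)$, let $\widetilde{r}$ be the linear recurrence sequence with domain $\mathrm{dom}(r)$, $\widetilde{r}(g)=r(g)$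 for $g\in\mathrm{supp}(r)$ and $\widetilde{r}(g)=1$ for $g\in\mathrm{dom}(r)\setminus\mathrm{supp}(r)$. For a map $\varphi\colon k((G))\to k((G))$, the map $\varphi^*\colon\mathrm{LRS}(k,G)\to\mathrm{LRS}(k,G)$ is defined by $\mathrm{dom}(\varphi^*(r))=\mathrm{supp}(\varphi(\widetilde{r}^{\,*}))$ and $\varphi^*(r)(g)=\varphi(r^* )(g)$ for $g\in\mathrm{dom}(\varphi^*(r))$. Lifting: $\mathrm{Aut}(k)$ is the group of field automorphisms of $k$ and $\mathrm{o\text{-}Aut}(G)$ the group of order preserving group automorphisms of $G$. $v\text{-}\mathrm{Aut}(K)$ is the group of valuation preserving automorphisms of $K$, i.e. field automorphisms $\sigma$ of $K$ such that $v(a)=v(b)$ implies $v(\sigma(a))=v(\sigma(b))$. The canonical lift of $(\rho,\tau)\in\mathrm{Aut}(k)\times\mathrm{o\text{-}Aut}(G)$ is $\widetilde{\rho\tau}\colon k((G))\to k((G))$, $\sum_gs_gt^g\mapsto\sum_g\rho(s_g)t^{\tau(g)}$. A Hahn field $K$ has the canonical first lifting property if $\widetilde{\rho\tau}|_K\in v\text{-}\mathrm{Aut}(K)$ for all $(\rho,\tau)\in\mathrm{Aut}(k)\times\mathrm{o\text{-}Aut}(G)$; equivalently, $\widetilde{\rho\tau}(s)\in K$ for all $s\in K$ and all such $(\rho,\tau)$. *)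

(* Defs.v *)
From HB Require Import structures.
From mathcomp Require Import all_boot all_order all_algebra.
From mathcomp Require Import boolp contra wochoice classical_sets functions.
From mathcomp Require Import cardinality fsbigop.

Set Implicit Arguments.
Unset Strict Implicit.
Unset Printing Implicit Defensive.

Import Order.TTheory GRing.Theory.
Local Open Scope classical_set_scope.
Local Open Scope ring_scope.


HB.mixin Record POrderedZmodule_isOrdered G of Num.POrderedZmodule G := {
  ole_total : forall x y : G, (x <= y) || (y <= x);
  oleD2r_subproof : forall z x y : G, x <= y -> x + z <= y + z
}.

(* Totality is a field of the mixin, and Order.Total is not inherited, because
   HB would require its join with Zmodule to be declared before Num.RealDomain. *)
#[short(type="orderedZmodType")]
HB.structure Definition OrderedZmodule :=
  { G of Num.POrderedZmodule G & POrderedZmodule_isOrdered G }.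

Section OrderedZmoduleTheory.
Variable G : orderedZmodType.
Implicit Types x y z : G.

Lemma oleNgt x y : (x <= y) = ~~ (y < x).
Proof. exact/comparable_leNgt/ole_total. Qed.

Lemma oltNge x y : (x < y) = ~~ (y <= x).
Proof. exact/comparable_ltNge/ole_total. Qed.

Lemma ole_add2r z x y : (x + z <= y + z) = (x <= y).
Proof.
apply/idP/idP => [/(oleD2r_subproof (- z))|]; last exact: oleD2r_subproof.
by rewrite !addrK.
Qed.

Lemma olt_add2r z x y : (x + z < y + z) = (x < y).
Proof. by rewrite !oltNge ole_add2r. Qed.

Lemma ole_add2l z x y : (z + x <= z + y) = (x <= y).
Proof. by rewrite ![z + _]addrC ole_add2r. Qed.

Lemma olt_add2l z x y : (z + x < z + y) = (x < y).
Proof. by rewrite ![z + _]addrC olt_add2r. Qed.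

Lemma ole_opp2 x y : (- x <= - y) = (y <= x).
Proof. by rewrite -[LHS](ole_add2r (x + y)) addKr addrC addrK. Qed.

End OrderedZmoduleTheory.


Section WellOrdered.
Variable G : orderedZmodType.
Implicit Types (A B C : set G) (x y z g h : G).

Definition well_ordered A : bool := `[< wo_chain <=%R (mem A) >].

Lemma well_orderedP A : well_ordered A <->
  forall B, B `<=` A -> B !=set0 -> exists2 m, B m & forall x, B x -> m <= x.
Proof.
rewrite /well_ordered asboolE; split=> [woA B BA [b Bb]|minA].
- have [||m [[Bm mmin] _]] := woA [in B].
  + by move=> x xB; apply: mem_set; apply: BA; move: xB; rewrite inE.
  + by exists b; apply: mem_set.
  exists m; first by rewrite inE in Bm.
  by move=> x Bx; apply: mmin; apply: mem_set.
- apply: antisymmetric_wo_chain => [x y _ _|B BA [b Bb]]; first exact: le_anti.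
  have [||m Bm mmin] := minA [set x | x \in B].
  + by move=> x /= /BA; rewrite inE.
  + by exists b.
  by exists m; split=> // x /mmin.
Qed.

Lemma well_ordered_sub A B : A `<=` B -> well_ordered B -> well_ordered A.
Proof.
move=> AB /well_orderedP woB; apply/well_orderedP => C CA.
by apply: woB; apply: subset_trans AB.
Qed.

Lemma well_ordered0 : well_ordered set0.
Proof. by apply/well_orderedP => B B0 [b /B0]. Qed.

Lemma well_ordered1 x : well_ordered [set x].
Proof.
apply/well_orderedP => B B1 [b Bb]; exists b => // y By.
by rewrite (B1 _ By) (B1 _ Bb).
Qed.

Lemma well_ordered_ind A (P : G -> Prop) : well_ordered A ->
    (forall x, A x -> (forall y, A y -> y < x -> P y) -> P x) ->
  forall x, A x -> P x.
Proof.
move=> /well_orderedP woA IH x Ax; apply: contrapT => nPx.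
have [||m [Am nPm] mmin] := woA [set y | A y /\ ~ P y].
- by move=> y [].
- by exists x.
apply: nPm; apply: IH => // y Ay ym; apply: contrapT => nPy.
by have := mmin y (conj Ay nPy); rewrite oleNgt ym.
Qed.

Lemma well_orderedU A B :
  well_ordered A -> well_ordered B -> well_ordered (A `|` B).
Proof.
move=> /well_orderedP woA /well_orderedP woB; apply/well_orderedP => C CAB [c Cc].
have [[a [Ca Aa]]|CA0] := pselect (C `&` A !=set0); last first.
  apply: woB; last by exists c.
  by move=> x Cx; have [Ax|//] := CAB _ Cx; case: CA0; exists x.
have [||m [Cm Am] mmin] := woA (C `&` A); [by move=> x []|by exists a|].
have [[b [Cb Bb]]|CB0] := pselect (C `&` B !=set0); last first.
  exists m => // x Cx; apply: mmin; split=> //.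
  by have [//|Bx] := CAB _ Cx; case: CB0; exists x.
have [||n [Cn Bn] nmin] := woB (C `&` B); [by move=> x []|by exists b|].
have [mn|nm] := comparable_leP (ole_total m n).
- exists m => // x Cx; have [Ax|Bx] := CAB _ Cx; first exact: mmin.
  by apply: le_trans mn _; apply: nmin.
- exists n => // x Cx; have [Ax|Bx] := CAB _ Cx; last exact: nmin.
  by apply: le_trans (ltW nm) _; apply: mmin.
Qed.

Definition sumset A B := [set h | exists2 g, A g & B (h - g)].

Lemma well_ordered_sumset A B :
  well_ordered A -> well_ordered B -> well_ordered (sumset A B).
Proof.
move=> woA woB; have /well_orderedP minA := woA.
suff key : forall b, B b -> forall C, C `<=` sumset A B ->
    (exists a, [/\ A a, C (a + b)
       & forall a' b', A a' -> B b' -> C (a' + b') -> a <= a']) ->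
    exists2 m, C m & forall x, C x -> m <= x.
  apply/well_orderedP => C CAB [c Cc].
  pose D := [set a | A a /\ exists2 b, B b & C (a + b)].
  have [||a [Aa [b Bb Cab]] amin] := minA D.
  - by move=> a [].
  - by have [a Aa Bca] := CAB _ Cc; exists a; split=> //; exists (c - a);
      rewrite // subrKC.
  apply: (key b) => //; exists a; split=> // a' b' Aa' Bb' Cab'.
  by apply: amin; split=> //; exists b'.
apply: (well_ordered_ind woB) => b Bb IH C CAB [a [Aa Cab amin]].
have [minab|] := pselect (forall x, C x -> a + b <= x); first by exists (a + b).
move=> /existsNP [c /not_implyP [Cc /negP]]; rewrite -oltNge => ltc.
pose C' := C `&` [set x | x < a + b].
pose D := [set a | A a /\ exists2 b, B b & C' (a + b)].
have [||a' [Aa' [b' Bb' [Cab' ltab']]] amin'] := minA D.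
- by move=> x [].
- by have [x Ax Bcx] := CAB _ Cc; exists x; split=> //; exists (c - x);
    rewrite // subrKC.
have ltb' : b' < b.
  rewrite -(olt_add2l a); apply: le_lt_trans ltab'.
  by rewrite ole_add2r; apply: amin Cab'.
have [||m [Cm ltm] mmin] := IH _ Bb' ltb' C'.
- by move=> x [/CAB].
- exists a'; split=> // a'' b'' Aa'' Bb'' Cab''.
  by apply: amin'; split=> //; exists b''.
exists m => // x Cx; have [ltx|] := comparable_ltP (ole_total x (a + b)); first exact: mmin.
by apply: le_trans; apply: ltW.
Qed.

Lemma finite_fibre A B h : well_ordered A -> well_ordered B ->
  finite_set (A `&` [set g | B (h - g)]).
Proof.
move=> woA /well_orderedP woB; set D := _ `&` _.
have woD : well_ordered D by apply: well_ordered_sub woA => x [].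
have maxD (E : set G) : E `<=` D -> E !=set0 ->
    exists2 m, E m & forall x, E x -> x <= m.
  move=> ED [e Ee]; have [||m Em mmin] := woB [set b | E (h - b)].
  - by move=> b /ED [_] /=; rewrite subKr.
  - by exists (h - e); rewrite /= subKr.
  exists (h - m) => // x Ex; rewrite -ole_opp2 -(ole_add2l h) opprB subrKC.
  by apply: mmin; rewrite /= subKr.
have finlt : forall x, D x -> finite_set (D `&` [set y | y < x]).
  apply: (well_ordered_ind woD) => x Dx IH.
  have [ne|/nonemptyPn ->] := pselect (D `&` [set y | y < x] !=set0) => //.
  have [|m [Dm ltmx] mmax] := maxD _ _ ne; first by move=> ? [].
  apply: (sub_finite_set (B := (D `&` [set y | y < m]) `|` [set m])).
    move=> y [Dy ltyx]; have := mmax y (conj Dy ltyx).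
    by rewrite le_eqVlt => /orP[/eqP ->|ltym]; [right|left].
  by rewrite finite_setU; split; [exact: IH|exact: finite_set1].
have [ne|/nonemptyPn ->] := pselect (D !=set0) => //.
have [//|m Dm mmax] := maxD _ _ ne.
apply: (sub_finite_set (B := (D `&` [set y | y < m]) `|` [set m])).
  move=> y Dy; have := mmax y Dy.
  by rewrite le_eqVlt => /orP[/eqP ->|ltym]; [right|left].
by rewrite finite_setU; split; [exact: finlt|exact: finite_set1].
Qed.

End WellOrdered.


Definition fsupp (k : fieldType) (G : orderedZmodType) (f : G -> k) : set G :=
  [set g | f g != 0].

Record hahn (k : fieldType) (G : orderedZmodType) := Hahn {
  hcoef :> G -> k;
  hahn_wo : well_ordered (fsupp hcoef)
}.

HB.instance Definition _ (k : fieldType) (G : orderedZmodType) :=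
  gen_eqMixin (hahn k G).
HB.instance Definition _ (k : fieldType) (G : orderedZmodType) :=
  gen_choiceMixin (hahn k G).

Section HahnRing.
Variables (k : fieldType) (G : orderedZmodType).
Implicit Types (s t u : hahn k G) (f : G -> k) (g h a : G).

Lemma hahnP s t : s =1 t -> s = t.
Proof.
case: s t => [s sP] [t tP] /= /funext st; subst t.
by congr Hahn; apply: bool_irrelevance.
Qed.

Lemma zero_wo : well_ordered (fsupp (fun _ : G => 0 : k)).
Proof. by apply: well_ordered_sub (well_ordered0 G) => x; rewrite /fsupp /= eqxx. Qed.
Definition hahn0 := Hahn zero_wo.

Definition mono_fun (c : k) g : G -> k := fun h => if h == g then c else 0.
Lemma mono_wo c g : well_ordered (fsupp (mono_fun c g)).
Proof.
apply: well_ordered_sub (well_ordered1 g) => x.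
by rewrite /fsupp /mono_fun /=; case: (x =P g) => //; rewrite eqxx.
Qed.
Definition monomial c g := Hahn (mono_wo c g).

Lemma add_wo s t : well_ordered (fsupp (fun g => s g + t g)).
Proof.
apply: well_ordered_sub (well_orderedU (hahn_wo s) (hahn_wo t)) => g.
rewrite /fsupp /=; have [->|sg _] := eqVneq (s g) 0; last by left.
by rewrite add0r => tg; right.
Qed.
Definition hahn_add s t := Hahn (add_wo s t).

Lemma opp_wo s : well_ordered (fsupp (fun g => - s g)).
Proof.
by apply: well_ordered_sub (hahn_wo s) => g; rewrite /fsupp /= oppr_eq0.
Qed.
Definition hahn_opp s := Hahn (opp_wo s).

(* All but finitely many terms of the sum vanish, see mul_finite. *)
Definition mul_fun s t : G -> k :=
  fun h => \sum_(g \in [set: G]) s g * t (h - g).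

Lemma mul_funN0 s t h : mul_fun s t h != 0 ->
  exists g, [/\ s g != 0 & t (h - g) != 0].
Proof.
move=> N0; have [g _] := @fsbigN1 _ 0 _ G G setT (fun h g => s g * t (h - g)) h N0.
by rewrite mulf_eq0 negb_or => /andP[sg tg]; exists g.
Qed.

Lemma mul_wo s t : well_ordered (fsupp (mul_fun s t)).
Proof.
apply: well_ordered_sub (well_ordered_sumset (hahn_wo s) (hahn_wo t)) => h.
by move=> /mul_funN0 [g [sg tg]]; exists g.
Qed.
Definition hahn_mul s t := Hahn (mul_wo s t).

Lemma mul_finite s t h : finite_set [set g | s g * t (h - g) != 0].
Proof.
apply: sub_finite_set (finite_fibre h (hahn_wo s) (hahn_wo t)) => g /=.
by rewrite mulf_eq0 negb_or => /andP[].
Qed.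

Lemma mul_funE s t h (A : set G) :
    (forall g, s g != 0 -> t (h - g) != 0 -> A g) ->
  mul_fun s t h = \sum_(g \in A) s g * t (h - g).
Proof.
move=> suppA; apply/esym/fsbig_widen => // g [_ nAg] /=; apply: contrapT.
by move=> /eqP; rewrite mulf_eq0 negb_or => /andP[sg tg]; apply/nAg/suppA.
Qed.

Fact addA : associative hahn_add.
Proof. by move=> s t u; apply: hahnP => g /=; rewrite addrA. Qed.
Fact addC : commutative hahn_add.
Proof. by move=> s t; apply: hahnP => g /=; rewrite addrC. Qed.
Fact add0 : left_id hahn0 hahn_add.
Proof. by move=> s; apply: hahnP => g /=; rewrite add0r. Qed.
Fact addN : left_inverse hahn0 hahn_opp hahn_add.
Proof. by move=> s; apply: hahnP => g /=; rewrite addNr. Qed.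

HB.instance Definition _ := GRing.isZmodule.Build (hahn k G) addA addC add0 addN.

Fact mulC : commutative hahn_mul.
Proof.
move=> s t; apply: hahnP => h /=; rewrite /mul_fun.
rewrite (reindex_fsbigT (fun g => h - g)) //; last first.
  by exists (fun g => h - g) => g; rewrite subKr.
by apply: eq_fsbigr => g _; rewrite subKr mulrC.
Qed.

Fact mulA : associative hahn_mul.
Proof.
move=> s t u; apply: hahnP => h /=.
pose X := sumset (fsupp s) (fsupp t) `&` [set x | fsupp u (h - x)].
have finX : finite_set X.
  by apply: finite_fibre (hahn_wo u); apply: well_ordered_sumset; apply: hahn_wo.
pose A := \bigcup_(x in X) (fsupp s `&` [set a | fsupp t (x - a)]).
have finA : finite_set A.
  by apply: bigcup_finite => // x _; apply: finite_fibre; apply: hahn_wo.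
have memX a y : s a != 0 -> t y != 0 -> u (h - a - y) != 0 -> X (a + y).
  move=> sa ty uay; split; first by exists a; rewrite // addrC addKr.
  by rewrite /= opprD addrA.
have memA a y : s a != 0 -> t y != 0 -> u (h - a - y) != 0 -> A a.
  move=> sa ty uay; exists (a + y); first exact: memX.
  by split=> //=; rewrite addrC addKr.
transitivity (\sum_(a \in A) \sum_(x \in X) s a * (t (x - a) * u (h - x))).
  rewrite (@mul_funE s (hahn_mul t u) h A); last first.
    by move=> a sa /mul_funN0 [y [ty uy]]; apply: (memA a y).
  apply: eq_fsbigr => a _; rewrite -mulr_fsumr.
  have [->|sa] := eqVneq (s a) 0; first by rewrite !mul0r.
  congr (_ * _); rewrite /= (@mul_funE t u (h - a) [set y | X (a + y)]); last first.
    by move=> y ty uy; apply: memX.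
  rewrite (reindex_fsbig (fun y => a + y) [set y | X (a + y)] X); last first.
    split=> //; first by move=> y1 y2 _ _ /addrI.
    by move=> x Xx; exists (x - a); rewrite /= subrKC.
  by apply: eq_fsbigr => y _; rewrite [a + y - a]addrC addKr opprD addrA.
rewrite exchange_fsbig // (@mul_funE (hahn_mul s t) u h X); last first.
  by move=> x /mul_funN0 [a [sa ta]] ux; split=> //; exists a.
apply: eq_fsbigr => x; rewrite inE => Xx /=.
rewrite (@mul_funE s t x A); last first.
  by move=> a sa ta; exists x.
by rewrite mulr_fsuml; apply: eq_fsbigr => a _; rewrite mulrA.
Qed.

Lemma mul_monomial c g s h : hahn_mul (monomial c g) s h = c * s (h - g).
Proof.
rewrite /= (@mul_funE (monomial c g) s h [set g]); last first.
  by move=> x /=; rewrite /mono_fun; case: (x =P g) => //; rewrite eqxx.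
by rewrite fsbig_set1 /= /mono_fun eqxx.
Qed.

Definition hahn1 := monomial 1 0.

Fact mul1 : left_id hahn1 hahn_mul.
Proof. by move=> s; apply: hahnP => h; rewrite mul_monomial mul1r subr0. Qed.

Fact mulDl : left_distributive hahn_mul +%R.
Proof.
move=> s t u; apply: hahnP => h /=.
pose A := (fsupp s `&` [set g | fsupp u (h - g)])
      `|` (fsupp t `&` [set g | fsupp u (h - g)]).
have finA : finite_set A.
  by rewrite finite_setU; split; apply: finite_fibre; apply: hahn_wo.
rewrite (@mul_funE s u h A); last by move=> g sg ug; left.
rewrite (@mul_funE t u h A); last by move=> g sg ug; right.
rewrite (@mul_funE (s + t) u h A); last first.
  move=> g /=; have [->|sg _ ug] := eqVneq (s g) 0; last by left.
  by rewrite add0r => tg ug; right.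
by rewrite -fsbig_split //; apply: eq_fsbigr => g _; rewrite mulrDl.
Qed.

Fact one_neq0 : hahn1 != 0.
Proof.
apply/eqP => /(congr1 (fun s : hahn k G => s 0)) /=.
by rewrite /mono_fun eqxx => /eqP; rewrite oner_eq0.
Qed.

HB.instance Definition _ := GRing.Zmodule_isComNzRing.Build (hahn k G)
  mulA mulC mul1 mulDl one_neq0.

Lemma coef0 g : (0 : hahn k G) g = 0. Proof. by []. Qed.
Lemma coef1 g : (1 : hahn k G) g = if g == 0 then 1 else 0. Proof. by []. Qed.
Lemma coefD s t g : (s + t) g = s g + t g. Proof. by []. Qed.
Lemma coefN s g : (- s) g = - s g. Proof. by []. Qed.
Lemma coefB s t g : (s - t) g = s g - t g. Proof. by []. Qed.
Lemma coefM s t h : (s * t) h = \sum_(g \in [set: G]) s g * t (h - g).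
Proof. by []. Qed.

Lemma hahn_neq0 s : s != 0 -> fsupp s !=set0.
Proof.
move=> s0; apply: contrapT => /nonemptyPn supp0; case/eqP: s0; apply: hahnP => g.
by apply/eqP/negPn/negP => sg; have : fsupp s g by []; rewrite supp0.
Qed.

Lemma hahn_min s : s != 0 ->
  exists2 m, s m != 0 & forall g, s g != 0 -> m <= g.
Proof.
move=> /hahn_neq0 ne; have /well_orderedP wo := hahn_wo s.
by have [//|m sm mmin] := wo _ _ ne; exists m.
Qed.

(** Every non-zero series is invertible: by Zorn's lemma, take a maximal partial
    inverse [y] of [x] for end extension. *)
Section Inverse.
Variables (x : hahn k G) (v : G).
Hypotheses (xv : x v != 0) (vmin : forall g, x g != 0 -> v <= g).

Let partial_inv (y : hahn k G) :=
  forall h g, y h != 0 -> (1 - x * y) g != 0 -> h + v < g.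
Let end_ext (y z : hahn k G) := forall g, y g != 0 -> forall h, h <= g -> z h = y h.

Lemma mul_trunc (y z : hahn k G) g : (forall h, h <= g - v -> z h = y h) ->
  (x * z) g = (x * y) g.
Proof.
move=> zy; rewrite !coefM; apply: eq_fsbigr => a _.
have [->|xa] := eqVneq (x a) 0; first by rewrite !mul0r.
by rewrite zy // ole_add2l ole_opp2 vmin.
Qed.

Lemma end_ext_chain (F : set (hahn k G)) :
    (forall y z, F y -> F z -> end_ext y z \/ end_ext z y) ->
  exists2 z, forall y, F y -> end_ext y z
           & forall g, z g != 0 -> exists2 y, F y & y g != 0.
Proof.
move=> totF; pose P g := exists2 y : hahn k G, F y & y g != 0.
pose f g := if pselect (P g) is left Pg then s2val (cid2 Pg) g else 0.
have fP g : f g != 0 -> P g.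
  by rewrite /f; case: pselect => // _; rewrite eqxx.
have fE (y : hahn k G) : F y -> forall g, y g != 0 -> forall h, h <= g -> f h = y h.
  move=> Fy g yg h hg; rewrite /f; case: pselect => [Ph|nPh]; last first.
    by apply/esym/eqP/negPn/negP => yh; apply: nPh; exists y.
  case: (cid2 Ph) => y' Fy' y'h /=.
  by have [E|E] := totF _ _ Fy Fy'; [apply: E yg _ hg|apply/esym/(E h y'h h)].
have f_wo : well_ordered (fsupp f).
  apply/well_orderedP => B Bf [b Bb]; have [y Fy yb] := fP _ (Bf _ Bb).
  have /well_orderedP wo := hahn_wo y.
  have [||m [Bm mb] mmin] := wo (B `&` [set h | h <= b]).
  - by move=> h [Bh hb]; rewrite /fsupp /= -(fE y Fy b yb h hb); apply: Bf.
  - by exists b; split=> //=.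
  exists m => // h Bh; have [hb|bh] := comparable_leP (ole_total h b); first exact: mmin.
  by apply: le_trans mb (ltW bh).
by exists (Hahn f_wo).
Qed.

Lemma hahn_inv_ex : exists y, x * y = 1.
Proof.
pose T := {y | partial_inv y}.
pose R : rel T := fun y z => `[< end_ext (sval y) (sval z) >].
have [||||Y ymax] := @Zorn T R.
- by move=> y; apply/asboolP.
- move=> y1 y2 y3 /asboolP E1 /asboolP E2; apply/asboolP => g yg h hg.
  by rewrite (E2 g) ?(E1 g).
- move=> [y Py] [z Pz] /asboolP /= E1 /asboolP /= E2; apply: eq_exist => /=.
  apply: hahnP => g; have [yg|yg] := eqVneq (y g) 0; last by rewrite (E1 g).
  by have [zg|zg] := eqVneq (z g) 0; [rewrite yg zg|rewrite (E2 g)].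
- move=> F totF; pose F' : set (hahn k G) := [set sval y | y in F].
  have [|z zext zsupp] := @end_ext_chain F'.
    move=> _ _ [y Fy <-] [z Fz <-].
    by have [/asboolP E|/asboolP E] := totF _ _ Fy Fz; [left|right].
  have Pz : partial_inv z.
    move=> h g zh zg; rewrite oltNge; apply/negP => gh.
    have [_ [y Fy <-] yh] := zsupp _ zh.
    have xzy : (x * z) g = (x * sval y) g.
      apply: mul_trunc => h' h'g; apply: (zext (sval y) _ h) => //.
        by exists y.
      by apply: le_trans h'g _; rewrite -(ole_add2r v) subrK.
    have := svalP y _ g yh; rewrite coefB -xzy -coefB => /(_ zg).
    by rewrite oltNge gh.
  by exists (exist _ z Pz) => y Fy; apply/asboolP/zext; exists y.
pose y := sval Y; have Py : partial_inv y := svalP Y.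
exists y; apply/esym/eqP; rewrite -subr_eq0; apply: contrapT => /negP w0.
have [g wg gmin] := hahn_min w0; pose w := 1 - x * y.
pose c := w g / x v; pose m := monomial c (g - v).
have mg : m (g - v) = c by rewrite /= /mono_fun eqxx.
have m0 h : h != g - v -> m h = 0 by rewrite /= /mono_fun => /negPf ->.
have c0 : c != 0 by rewrite mulf_neq0 ?invr_eq0.
have xm h : (x * m) h = c * x (h - (g - v)).
  by rewrite mulrC [LHS]mul_monomial.
have wmin h : (1 - x * (y + m)) h != 0 -> g < h.
  rewrite mulrDr opprD addrA coefB xm -/w => N0; rewrite oltNge; apply/negP.
  rewrite le_eqVlt => /orP[/eqP eqh|ltgh]; case/eqP: N0.
    by rewrite eqh subKr /c divfK ?subrr.
  have -> : w h = 0.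
    by apply/eqP/negPn/negP => /gmin; rewrite oleNgt ltgh.
  suff -> : x (h - (g - v)) = 0 by rewrite mulr0 subr0.
  apply/eqP/negPn/negP => /vmin; rewrite opprB addrCA -[leLHS]addr0 ole_add2l.
  by rewrite oleNgt -(olt_add2r g) subrK add0r ltgh.
have Pym : partial_inv (y + m).
  move=> h g' yh /wmin ltg; apply: le_lt_trans ltg.
  have [->|hg] := eqVneq h (g - v); first by rewrite subrK.
  by move: yh; rewrite coefD (m0 _ hg) addr0 => yh; apply/ltW/Py.
have /ymax : R Y (exist _ (y + m) Pym).
  apply/asboolP => h yh h' h'h /=; rewrite -[LHS]/((y + m) h') coefD m0 ?addr0 //.
  rewrite lt_eqF // (le_lt_trans h'h) // -(olt_add2r v) subrK.
  exact: Py.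
move=> /(congr1 (fun z : T => sval z (g - v))) /=; rewrite -[LHS]/((y + m) _).
rewrite coefD mg => /eqP; rewrite -subr_eq0 addrC addKr.
by apply/negP.
Qed.

End Inverse.

Fact hahn_inv_proof (x : hahn k G) : exists y, if x == 0 then y = 0 else x * y = 1.
Proof.
case: eqVneq => [_|x0]; first by exists 0.
by have [v xv vmin] := hahn_min x0; apply: (hahn_inv_ex xv vmin).
Qed.
Definition hahn_inv x := sval (cid (hahn_inv_proof x)).

Fact hahn_mulV (x : hahn k G) : x != 0 -> hahn_inv x * x = 1.
Proof.
by rewrite /hahn_inv; case: cid => y /= + /negPf x0; rewrite x0 mulrC.
Qed.
Fact hahn_inv0 : hahn_inv 0 = 0.
Proof. by rewrite /hahn_inv; case: cid => y /=; rewrite eqxx. Qed.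

HB.instance Definition _ :=
  GRing.ComNzRing_isField.Build (hahn k G) hahn_mulV hahn_inv0.

End HahnRing.


Section HahnField.
Variables (k : fieldType) (G : orderedZmodType).
Implicit Types (s : hahn k G) (K : set (hahn k G)).

Definition group_ring : set (hahn k G) := [set s | finite_set (fsupp s)].

Definition group_ring_frac : set (hahn k G) :=
  [set s | exists a b, [/\ group_ring a, group_ring b, b != 0 & s = a / b]].

Definition Hahn_field K :=
  GRing.divring_closed (mem K) /\ group_ring_frac `<=` K.

(* [None] stands for the value of 0. *)
Definition hval s : option G :=
  if s == 0 then None
  else Some (xget 0 [set m | fsupp s m /\ (forall g, fsupp s g -> m <= g)]).

(* [sigma] restricts to a valuation preserving field automorphism of [K]. *)
Definition in_vAut K (sigma : hahn k G -> hahn k G) :=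
  [/\ set_bij K K sigma,
      sigma 1 = 1,
      {in K &, {morph sigma : a b / a + b}},
      {in K &, {morph sigma : a b / a * b}}
    & {in K &, forall a b, hval a = hval b -> hval (sigma a) = hval (sigma b)} ].

End HahnField.


Section LRS.
Variables (k : fieldType) (G : orderedZmodType).

Definition pdom (r : G -> option k) : set G := [set g | isSome (r g)].

(* Partial functions from G to k, undefined where they take the value [None]. *)
Record LRS := MkLRS {
  lrs_val :> G -> option k;
  lrs_wo : well_ordered (pdom lrs_val)
}.
Implicit Types (r : LRS) (R : set LRS) (s : hahn k G).

Lemma lrsP r r' : r =1 r' -> r = r'.
Proof.
case: r r' => [r rP] [r' rP'] /= /funext rr'; subst r'.
by congr MkLRS; apply: bool_irrelevance.
Qed.

(* Extended by 0 outside the domain of r. *)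
Definition lrs_coef r g : k := odflt 0 (r g).

Lemma lrs_series_wo r : well_ordered (fsupp (lrs_coef r)).
Proof.
apply: well_ordered_sub (lrs_wo r) => g; rewrite /fsupp /pdom /lrs_coef /=.
by case: (r g) => //=; rewrite eqxx.
Qed.
Definition lrs_series r : hahn k G := Hahn (lrs_series_wo r).

(* All but finitely many terms of the sum vanish, see lrs_sum_finite. *)
Definition lrs_space r : set (hahn k G) :=
  [set s | forall h, ~ pdom r h -> \sum_(g \in pdom r) lrs_coef r g * s (h - g) = 0].

Lemma lrs_sum_finite r s h :
  finite_set (pdom r `&` [set g | lrs_coef r g * s (h - g) != 0]).
Proof.
apply: sub_finite_set (mul_finite (lrs_series r) s h).
by move=> g [].
Qed.

Definition lrs_union R : set (hahn k G) := \bigcup_(r in R) lrs_space r.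

Definition tilde_val r : G -> option k :=
  fun g => omap (fun c => if c == 0 then 1 else c) (r g).
Lemma tilde_wo r : well_ordered (pdom (tilde_val r)).
Proof.
by apply: well_ordered_sub (lrs_wo r) => g; rewrite /pdom /tilde_val /=; case: (r g).
Qed.
Definition lrs_tilde r : LRS := MkLRS (tilde_wo r).

Section Star.
Variable phi : hahn k G -> hahn k G.

Definition star_val r : G -> option k :=
  fun g => if phi (lrs_series (lrs_tilde r)) g != 0
           then Some (phi (lrs_series r) g) else None.
Lemma star_wo r : well_ordered (pdom (star_val r)).
Proof.
apply: well_ordered_sub (hahn_wo (phi (lrs_series (lrs_tilde r)))) => g.
by rewrite /pdom /star_val /fsupp /=; case: ifP.
Qed.
Definition lrs_star r : LRS := MkLRS (star_wo r).

End Star.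

End LRS.


Record fieldAut (k : fieldType) := FieldAut {
  field_aut :> {rmorphism k -> k};
  field_aut_bij : bijective field_aut
}.

Record orderAut (G : orderedZmodType) := OrderAut {
  order_aut :> {additive G -> G};
  order_aut_bij : bijective order_aut;
  order_aut_homo : {homo order_aut : x y / x <= y}
}.

Section Lift.
Variables (k : fieldType) (G : orderedZmodType).
Variables (rho : fieldAut k) (tau : orderAut G).

(* The coefficient of t^h in the sum of the rho(s_g) t^(tau g). *)
Definition lift_fun (s : hahn k G) : G -> k :=
  fun h => \sum_(g \in [set g | tau g = h]) rho (s g).

Lemma lift_funE s g : lift_fun s (tau g) = rho (s g).
Proof.
rewrite /lift_fun; transitivity (\sum_(h \in [set g]) rho (s h)).
  apply: eq_fsbigl; apply/seteqP; split=> [h|h ->] //=.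
  exact: (bij_inj (order_aut_bij tau)).
by rewrite fsbig_set1.
Qed.

Lemma lift_wo s : well_ordered (fsupp (lift_fun s)).
Proof.
have [tau' tauK tau'K] := order_aut_bij tau.
apply/well_orderedP => B Bs [b Bb]; have /well_orderedP wo := hahn_wo s.
have [||m Bm mmin] := wo [set g | B (tau g)].
- move=> g /= /Bs; rewrite /fsupp /= lift_funE.
  by rewrite fmorph_eq0.
- by exists (tau' b); rewrite /= tau'K.
exists (tau m) => // h Bh; rewrite -[h]tau'K order_aut_homo //.
by apply: mmin; rewrite /= tau'K.
Qed.

Definition canonical_lift (s : hahn k G) : hahn k G := Hahn (lift_wo s).

End Lift.

Definition canonical_first_lifting (k : fieldType) (G : orderedZmodType)
    (K : set (hahn k G)) :=
  forall (rho : fieldAut k) (tau : orderAut G), in_vAut K (canonical_lift rho tau).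

(* Main.v *)
(** The canonical lift [phi] of [(rho, tau)] is a field automorphism of [k((G))]
    translating valuations by [tau]. A series [s] lies in [<r>] exactly when the
    product [r^* s] is supported on [dom r]; since [phi (r^* s)] is the product of
    [(phi^* r)^*] and [phi s], and [dom (phi^* r)] is the image of [dom r] under
    [tau], [phi] maps [<r>] into [<phi^* r>]. So [phi] and its inverse, which is
    the lift of [(rho^-1, tau^-1)], both map [K] into itself. *)
Require Import Defs.
From HB Require Import structures.
From mathcomp Require Import all_boot all_order all_algebra.
From mathcomp Require Import boolp classical_sets functions cardinality fsbigop.

Set Implicit Arguments.
Unset Strict Implicit.
Unset Printing Implicit Defensive.

Import Order.TTheory GRing.Theory.
Local Open Scope classical_set_scope.
Local Open Scope ring_scope.

Lemma fieldAut_inv (k : fieldType) (rho : fieldAut k) :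
  exists rho' : fieldAut k, cancel rho rho' /\ cancel rho' rho.
Proof.
have [f rhoK fK] := field_aut_bij rho.
pose fA := GRing.isZmodMorphism.Build k k f (can2_zmod_morphism rhoK fK).
pose fM := GRing.isMonoidMorphism.Build k k f (can2_monoid_morphism rhoK fK).
pose F : {rmorphism k -> k} := HB.pack f fA fM.
by exists (@FieldAut k F (Bijective fK rhoK)).
Qed.

Section OrderAut.
Variables (G : orderedZmodType) (tau : orderAut G).

(** Reflection of the order comes from totality: if [y < x], then injectivity makes [tau y < tau x]
    strict. *)
Lemma order_autE : {mono tau : x y / x <= y}.
Proof.
move=> x y; apply/idP/idP; last exact: order_aut_homo.
rewrite !oleNgt; apply: contraNN => yx.
rewrite lt_neqAle order_aut_homo ?ltW // andbT.
by rewrite (inj_eq (bij_inj (order_aut_bij tau))) lt_eqF.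
Qed.

Lemma orderAut_inv :
  exists tau' : orderAut G, cancel tau tau' /\ cancel tau' tau.
Proof.
have [f tauK fK] := order_aut_bij tau.
pose fA := GRing.isZmodMorphism.Build G G f (can2_zmod_morphism tauK fK).
pose F : {additive G -> G} := HB.pack f fA.
have Fhomo : {homo F : x y / x <= y}.
  by move=> x y; rewrite -[x in x <= _]fK -[y in _ <= y]fK order_autE.
by exists (@OrderAut G F (Bijective fK tauK) Fhomo).
Qed.

End OrderAut.

Section HahnValuation.
Variables (k : fieldType) (G : orderedZmodType).
Implicit Types (s : hahn k G) (m : G).

(** Trades the choice in [xget] for the property that pins it down: a least element of the support
    exists by well-ordering and is unique by antisymmetry. *)
Lemma hval_eqSome s m :
  hval s = Some m <-> s m != 0 /\ (forall g, s g != 0 -> m <= g).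
Proof.
split=> [|[sm mmin]]; rewrite /hval.
  case: eqP => // /eqP s0 [<-]; have [n sn nmin] := hahn_min s0.
  case: xgetP => [x _ []//|/(_ n) []]; split=> //.
have /negPf -> : s != 0 by apply: contraNN sm => /eqP ->.
congr Some; apply: xget_unique => [|y [sy ymin]]; first by split.
by apply: le_anti; rewrite mmin // ymin.
Qed.

Lemma hval_eqNone s : hval s = None <-> s = 0.
Proof. by rewrite /hval; case: eqP => // ->; split. Qed.

End HahnValuation.

Section LinearRecurrence.
Variables (k : fieldType) (G : orderedZmodType).
Implicit Types (r : LRS k G) (s : hahn k G).

(** As [lrs_coef r] vanishes off [pdom r], the recurrence sum at [h] is the full convolution at
    [h]. *)
Lemma lrs_spaceP r s :
  lrs_space r s <-> forall h, ~ pdom r h -> (lrs_series r * s) h = 0.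
Proof.
have sumE h : (lrs_series r * s) h = \sum_(g \in pdom r) lrs_coef r g * s (h - g).
  apply: mul_funE => g; rewrite /= /lrs_coef /pdom /=.
  by case: (r g) => //=; rewrite eqxx.
by split=> rs h /rs; rewrite sumE.
Qed.

(** Zero values on the domain have become 1, so the support of this series recovers the whole
    domain, which [lrs_series r] alone may not. *)
Lemma lrs_tilde_neq0 r g : lrs_series (lrs_tilde r) g != 0 = (r g : bool).
Proof.
rewrite /= /lrs_coef /= /tilde_val; case: (r g) => [c|] /=; last by rewrite eqxx.
by have [_|->//] := eqVneq c 0; rewrite oner_eq0.
Qed.

End LinearRecurrence.

Section CanonicalLift.
Variables (k : fieldType) (G : orderedZmodType).
Variables (rho : fieldAut k) (tau : orderAut G).
Implicit Types (s t : hahn k G) (r : LRS k G).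

Local Notation phi := (canonical_lift rho tau).

Lemma canonical_liftE s g : phi s (tau g) = rho (s g).
Proof. exact: lift_funE. Qed.

(** Every exponent has the form [tau g], so comparing coefficients there suffices. *)
Lemma canonical_lift_eqP s t :
  (forall g, t (tau g) = rho (s g)) -> phi s = t.
Proof.
have [tau' tauK tau'K] := order_aut_bij tau.
by move=> ts; apply: hahnP => h; rewrite -[h]tau'K canonical_liftE.
Qed.

Fact canonical_lift_zmod_morphism : zmod_morphism phi.
Proof.
move=> s t; apply: canonical_lift_eqP => g.
by rewrite !Defs.coefB !canonical_liftE rmorphB.
Qed.

Fact canonical_lift_monoid_morphism : monoid_morphism phi.
Proof.
split=> [|s t]; apply: canonical_lift_eqP => g.
  rewrite !Defs.coef1 -{1}(raddf0 tau) (inj_eq (bij_inj (order_aut_bij tau))).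
  by case: ifP; rewrite ?rmorph1 ?rmorph0.
rewrite !Defs.coefM (reindex_fsbigT tau); last exact: order_aut_bij.
under eq_fsbigr do rewrite -raddfB !canonical_liftE -rmorphM.
(* [rho] commutes with finite sums, so both convolutions are first cut down to the finite set [A]
   carrying all their non-zero terms. *)
pose A := fsupp s `&` [set a | fsupp t (g - a)].
have finA : finite_set A by apply: finite_fibre; apply: hahn_wo.
have AP a : ~ A a -> s a * t (g - a) = 0.
  move=> nAa; apply/eqP/negPn/negP; rewrite mulf_eq0 negb_or => /andP[sa ta].
  exact: nAa.
rewrite -!(@fsbig_widen _ _ _ _ A setT) //; last first.
- by move=> a [_ /AP /= ->]; rewrite rmorph0.
- by move=> a [_ /AP].
by rewrite !fsbig_finite //= rmorph_sum.
Qed.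

HB.instance Definition _ := GRing.isZmodMorphism.Build
  (hahn k G) (hahn k G) phi canonical_lift_zmod_morphism.
HB.instance Definition _ := GRing.isMonoidMorphism.Build
  (hahn k G) (hahn k G) phi canonical_lift_monoid_morphism.

Lemma hval_canonical_lift s : hval (phi s) = omap tau (hval s).
Proof.
case sE: (hval s) => [m|] /=; last first.
  by move: sE => /hval_eqNone ->; rewrite rmorph0; apply/hval_eqNone.
move: sE => /hval_eqSome [sm mmin]; apply/hval_eqSome.
have [tau' tauK tau'K] := order_aut_bij tau.
split=> [|g]; first by rewrite canonical_liftE fmorph_eq0.
by rewrite -[g]tau'K canonical_liftE fmorph_eq0 order_autE; apply: mmin.
Qed.

Lemma pdom_lrs_star r g : pdom (lrs_star phi r) (tau g) = pdom r g.
Proof.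
rewrite /pdom /= /star_val canonical_liftE fmorph_eq0 lrs_tilde_neq0.
by case: (r g).
Qed.

(** Restricting to the support of the lifted tilde series loses nothing: off it [r] is undefined, so
    the lift of [lrs_series r] vanishes there too. *)
Lemma lrs_series_star r : lrs_series (lrs_star phi r) = phi (lrs_series r).
Proof.
apply/esym/canonical_lift_eqP => g /=.
rewrite {1}/lrs_coef /= /star_val !canonical_liftE fmorph_eq0 lrs_tilde_neq0 /=.
by rewrite /lrs_coef; case: (r g) => //=; rewrite rmorph0.
Qed.

Lemma lrs_space_star r s :
  lrs_space r s -> lrs_space (lrs_star phi r) (phi s).
Proof.
have [tau' tauK tau'K] := order_aut_bij tau.
move=> /lrs_spaceP rs; apply/lrs_spaceP => h.
rewrite -[h]tau'K pdom_lrs_star lrs_series_star -rmorphM canonical_liftE.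
by move=> /rs ->; rewrite rmorph0.
Qed.

Lemma lrs_union_star (R : set (LRS k G)) s :
  lrs_star phi @` R `<=` R -> lrs_union R s -> lrs_union R (phi s).
Proof.
move=> RR [r Rr rs]; exists (lrs_star phi r); first by apply: RR; exists r.
exact: lrs_space_star.
Qed.

End CanonicalLift.

Lemma canonical_lift_can (k : fieldType) (G : orderedZmodType)
    (rho rho' : fieldAut k) (tau tau' : orderAut G) :
    cancel rho rho' -> cancel tau tau' ->
  cancel (canonical_lift rho tau) (canonical_lift rho' tau').
Proof.
move=> rhoK tauK s; apply: canonical_lift_eqP => g.
(* [tauK] cancels on one side only; injectivity of [tau'] supplies the other. *)
have -> : g = tau (tau' g) by apply: (bij_inj (order_aut_bij tau')); rewrite tauK.
by rewrite tauK canonical_liftE rhoK.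
Qed.

Theorem theorem8p6 (k : fieldType) (G : orderedZmodType) (R : set (LRS k G))
    (K : set (hahn k G)) (KE : K = lrs_union R) (HK : Hahn_field K)
    (HR : forall (rho : fieldAut k) (tau : orderAut G),
      lrs_star (canonical_lift rho tau) @` R `<=` R) :
  canonical_first_lifting K.
Proof.
(* Proved for all pairs, since surjectivity on [K] needs it for the inverse pair. *)
have liftK rho tau s : K s -> K (canonical_lift rho tau s).
  by rewrite KE; apply: lrs_union_star.
move=> rho tau.
have [rho' [rhoK rho'K]] := fieldAut_inv rho.
have [tau' [tauK tau'K]] := orderAut_inv tau.
split.
- split=> [s /liftK //|s t _ _|s Ks].
  + exact: (can_inj (canonical_lift_can rhoK tauK)).
  + exists (canonical_lift rho' tau' s); first exact: liftK.
    exact: canonical_lift_can.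
- exact: rmorph1.
- by move=> a b _ _; rewrite rmorphD.
- by move=> a b _ _; rewrite rmorphM.
- by move=> a b _ _ ab; rewrite !hval_canonical_lift ab.
Qed.
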